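(* Let $f:\mathbb{R}^n\to\mathbb{R}\cup\{\infty\}$ be convex and differentiable, let $X\subseteq\mathrm{dom}(f)$ be convex, and let $D:X\times X\to\mathbb{R}_+$ satisfy $D(y,x)\ge0$ and $D(x,x)=0$ for all $x,y\in X$. Suppose $f^\star:=\min_{x\in X}f(x)$ is finite, $X^\star:=\{x\in X:f(x)=f^\star\}\ne\emptyset$, and the map $x\mapsto\bar x:=\mathrm{argmin}_{y\in X^\star}D(y,x)$ is well defined for all $x\in X$. If $\mu>0$ is such that \[ D_f(Z_{f,X}(y),x)\ge\mu\,D(Z_{f,X}(y),x)\quad\text{for all }x,y\in X, \] then \[ D_f(\bar x,x)\ge\mu\,D(\bar x,x)\quad\text{for all }x\in X. \]
   Context: Bregman distance: $D_f(y,x)=f(y)-f(x)-\langle\nabla f(x),y-x\rangle$. For nonempty $S\subseteq X$, $D_f(S,x):=\inf_{y\in S}D_f(y,x)$ and $D(S,x):=\inf_{y\in S}D(y,x)$. For $y\in X$, $Z_{f,X}(y):=\{x\in X: f(x)=f(y)\text{ and }\langle\nabla f(x)-\nabla f(y),x-y\rangle=0\}$. The point $\bar x$ is a minimizer of $D(\cdot,x)$ over $X^\star$ (a fixed choice of one if it is not unique). *)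

(* Defs.v *)
(* R^n is 'rV[R]_n. Its library norm is the sup norm; being equivalent to the
   Euclidean one, it yields the usual neighbourhoods and differentiability. *)
From HB Require Import structures.
From mathcomp Require Export all_boot all_order all_algebra.
From mathcomp Require Export all_classical all_reals all_analysis.

Set Implicit Arguments.
Unset Strict Implicit.
Unset Printing Implicit Defensive.

Import Order.TTheory GRing.Theory Num.Theory.
Import numFieldNormedType.Exports.

Local Open Scope classical_set_scope.
Local Open Scope ring_scope.

Section Bregman.
Context {R : realType} {n : nat}.
Local Notation E := 'rV[R]_n.

Definition inner (u v : E) : R := \sum_(i < n) u 0 i * v 0 i.

Definition edom (f : E -> \bar R) : set E := [set x | (f x < +oo)%E].

(* The convention 0 * +oo = 0 of \bar R makes the endpoints t = 0, 1 harmless. *)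
Definition convex_efun (f : E -> \bar R) : Prop :=
  forall (x y : E) (t : R), 0 <= t <= 1 ->
    (f (t *: x + (1 - t) *: y)%R <= t%:E * f x + (1 - t)%:E * f y)%E.

(* Differentiability at x includes finiteness of f near x: without it the value
   fine +oo = 0 would leak into the derivative. *)
Definition edifferentiable (f : E -> \bar R) (x : E) : Prop :=
  nbhs x (edom f) /\ differentiable (fine \o f) x.

Definition gradient (f : E -> \bar R) (x : E) : E :=
  \row_(i < n) 'D_(delta_mx 0 i) (fine \o f) x.

Definition bregman (f : E -> \bar R) (y x : E) : \bar R :=
  (f y - f x - (inner (gradient f x) (y - x)%R)%:E)%E.

Definition set_dist (d : E -> E -> \bar R) (S : set E) (x : E) : \bar R :=
  ereal_inf [set d y x | y in S].

Definition Zset (f : E -> \bar R) (X : set E) (y : E) : set E :=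
  [set x | [/\ X x, f x = f y &
               inner (gradient f x - gradient f y) (x - y) = 0]].

Definition is_min (A : set (\bar R)) (m : \bar R) : Prop := A m /\ lbound A m.

Definition level_set (f : E -> \bar R) (X : set E) (c : \bar R) : set E :=
  [set x | X x /\ f x = c].

Definition argmin_on (A : set E) (g : E -> R) : set E :=
  [set y | A y /\ forall z, A z -> g y <= g z].

End Bregman.

(* Main.v *)
(* Every point of Z_{f,X}(bar x) lies in X^star because it has the same value of
   f, so bar x minimizes D(., x) over Z_{f,X}(bar x); and bar x itself belongs
   to Z_{f,X}(bar x). The hypothesis at y = bar x thus sandwiches the claim. *)
Require Import Defs.

Import Order.TTheory GRing.Theory Num.Theory.
Import numFieldNormedType.Exports.

Local Open Scope classical_set_scope.
Local Open Scope ring_scope.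

Theorem proposition1 (R : realType) (n : nat)
    (f : 'rV[R]_n -> \bar R) (X : set 'rV[R]_n)
    (D : 'rV[R]_n -> 'rV[R]_n -> R)
    (fstar : \bar R) (bar : 'rV[R]_n -> 'rV[R]_n) (mu : R)
    (f_proper : forall x, (-oo < f x)%E)
    (f_convex : convex_efun f)
    (f_diff : forall x, edom f x -> edifferentiable f x)
    (X_dom : X `<=` edom f)
    (X_convex : convex_set X)
    (D_ge0 : forall x y, X x -> X y -> 0 <= D y x)
    (D_refl : forall x, X x -> D x x = 0)
    (fstar_min : is_min (f @` X) fstar)
    (fstar_fin : fstar \is a fin_num)
    (Xstar_neq0 : level_set f X fstar !=set0)
    (bar_argmin : forall x, X x ->
       argmin_on (level_set f X fstar) (fun y => D y x) (bar x))
    (mu_gt0 : 0 < mu)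
    (hZ : forall x y, X x -> X y ->
       (mu%:E * set_dist (fun u v => (D u v)%:E) (Zset f X y) x
          <= set_dist (bregman f) (Zset f X y) x)%E) :
  forall x, X x -> (mu%:E * (D (bar x) x)%:E <= bregman f (bar x) x)%E.
Proof.
move=> x Xx.
have [[Xb fb] b_min] := bar_argmin x Xx.
have Zb : Zset f X (bar x) (bar x).
  (* The gradient difference is the zero vector, so each term of the inner product vanishes. *)
  by split=> //; rewrite subrr /inner big1 // => i _; rewrite mxE mul0r.
have le_D : ((D (bar x) x)%:E
    <= set_dist (fun u v => (D u v)%:E) (Zset f X (bar x)) x)%E.
  (* It suffices to bound each value [D z x] from below; [fz] and [fb] give [f z = fstar], which
     puts [z] in the range of [b_min]. *)
  apply: le_ereal_inf_tmp => _ [z [Xz fz _] <-].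
  by rewrite lee_fin; apply: b_min; split=> //; rewrite fz.
(* With Z the set [Zset f X (bar x)], the chain is mu D(bar x, x) <= mu D(Z, x) <= D_f(Z, x) <=
   D_f(bar x, x); the last link is [Zb]. *)
apply: (le_trans (lee_wpmul2l _ le_D)); first by rewrite lee_fin ltW.
apply: (le_trans (hZ x (bar x) Xx Xb)).
by apply: ereal_inf_lbound; exists (bar x).
Qed.
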